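(* There exist games where no small (i.e., of length polynomial in the number of actions and the payoff values) repeating cycle of actions can achieve any positive-factor multiplicative approximation or fixed-error additive approximation of the optimal payoff against $\mathsf{ERM}$. Precisely: for every polynomial $q$ in two variables and every $C>0$ there exist a finite two-player normal-form game, with $N=|\mathcal{A}|+|\mathcal{B}|$ actions and with payoffs of absolute value at most $W$ (where $W$ is the maximum absolute value of a payoff), and a number of rounds $T$, such that for every $\ell\le q(N,W)$ and every $(x_1,\dots,x_\ell)\in\mathcal{A}^\ell$, the sequence $a_t=x_{((t-1)\bmod \ell)+1}$, $t=1,\dots,T$, obtained by repeating $(x_1,\dots,x_\ell)$, has cumulative payoff against $\mathsf{ERM}$ that is less than $\rho\cdot\mathrm{OPT}$ for every $\rho>0$ and less than $\mathrm{OPT}-C$, where $\mathrm{OPT}$ is the maximum cumulative payoff of player $A$ over $T$ rounds against $\mathsf{ERM}$.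
   Context: Setting. A two-player normal-form game is repeated for $T$ rounds. Player $A$ (the optimizer, row player) has a finite action set $\mathcal{A}$, player $B$ (the opponent, column player) has a finite action set $\mathcal{B}$, with utilities $u^A,u^B:\mathcal{A}\times\mathcal{B}\to\mathbb{R}$ received once per round (payoffs may depend on $T$). Empirical Risk Minimization ($\mathsf{ERM}$): in round $t$, when player $A$ has played $a_1,\dots,a_{t-1}$, player $B$ plays $b_t=\mathsf{ERM}([a_1,\dots,a_{t-1}])=\arg\max_{b\in\mathcal{B}}\sum_{i=1}^{t-1}u^B(a_i,b)$, ties broken in favour of the leftmost action in a fixed order on $\mathcal{B}$ (in round 1 all actions are tied). The cumulative payoff of $(a_1,\dots,a_T)\in\mathcal{A}^T$ is $\sum_{t=1}^T u^A(a_t,b_t)$, and $\mathrm{OPT}$ is its maximum over $\mathcal{A}^T$. *)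

(* Defs.v *)
From mathcomp Require Import all_boot all_order all_algebra.
From mathcomp Require Import reals.
From mathcomp Require Import mpoly.

Set Implicit Arguments.
Unset Strict Implicit.
Unset Printing Implicit Defensive.

Import Order.TTheory GRing.Theory Num.Theory.
Local Open Scope ring_scope.

(* The row player's actions are 'I_m.+1 and the column player's are 'I_n.+1, *)
(* so both action sets are nonempty and the fixed left-to-right order on the *)
(* columns is the order of the ordinals. Rounds are numbered from 0.         *)

Section Game.

Variables (R : realType) (m n : nat) (uA uB : 'I_m.+1 -> 'I_n.+1 -> R).

Definition score (h : seq 'I_m.+1) (b : 'I_n.+1) : R := \sum_(a <- h) uB a b.

Definition best_response (h : seq 'I_m.+1) : 'I_n.+1 :=
  [arg max_(b > ord0) score h b]%O.

(* The outer arg min breaks ties: it selects the leftmost maximizer. *)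
Definition ERM (h : seq 'I_m.+1) : 'I_n.+1 :=
  [arg min_(b < best_response h | score h b == score h (best_response h))
     nat_of_ord b]%N.

Definition payoff (s : seq 'I_m.+1) : R :=
  \sum_(t < size s) uA (nth ord0 s t) (ERM (take t s)).

Definition OPT (T : nat) : R :=
  payoff [arg max_(s > nseq_tuple T ord0) payoff (tval s)]%O.

Definition max_payoff : R :=
  \big[Num.max/0]_(p : 'I_m.+1 * 'I_n.+1)
     Num.max `|uA p.1 p.2| `|uB p.1 p.2|.

Lemma ERM_max h b : score h b <= score h (ERM h).
Proof.
rewrite /ERM; case: arg_minnP => //= i /eqP -> _.
by rewrite /best_response; case: arg_maxP => //= j _; apply.
Qed.

Lemma ERM_leftmost h (b : 'I_n.+1) : (b < ERM h)%N -> score h b < score h (ERM h).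
Proof.
move=> lt_b; rewrite lt_neqAle ERM_max andbT; apply/eqP => eq_b.
move: lt_b eq_b; rewrite /ERM; case: arg_minnP => //= i /eqP -> min_i.
by rewrite ltnNge => /negP + eq_b; apply; apply/min_i/eqP.
Qed.

Lemma payoff_le_OPT T (s : T.-tuple 'I_m.+1) : payoff s <= OPT T.
Proof. by rewrite /OPT; case: arg_maxP => //= s0 _; apply. Qed.

End Game.

Definition repeat_cycle (A : Type) (x0 : A) (x : seq A) (T : nat) : seq A :=
  mkseq (fun t => nth x0 x (t %% size x)) T.

(* Main.v *)
(** A 2x2 game with payoffs of absolute value at most 1 suffices. The row player
gets 0 from action 0; action 1 earns 1 against column 1 and -1 against column 0.
Each past 0 gives column 1 only the tiny score 1/K, each past 1 costs it 1, so ERM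
plays column 1 exactly when the number of past 0s exceeds K times the number of
past 1s. Playing K M times 0 and then M times 1 earns M. A cycle of length l with
2 l <= K either consists of 0s only, and earns nothing, or plays 1 at least
once in every l rounds: it earns at most 1 from its first 1, and -1 from each
later one. As the payoffs stay bounded by 1, K can be chosen after the bound
on l. *)

Require Import Defs.
From mathcomp Require Import all_boot all_order all_algebra.
From mathcomp Require Import reals.
From mathcomp Require Import mpoly.
From mathcomp Require Import zify lra.

Set Implicit Arguments.
Unset Strict Implicit.
Unset Printing Implicit Defensive.

Import Order.TTheory GRing.Theory Num.Theory.
Local Open Scope ring_scope.

Lemma payoff_nil (R : realType) (m n : nat) (uA uB : 'I_m.+1 -> 'I_n.+1 -> R) :
  payoff uA uB [::] = 0.
Proof. by rewrite /payoff big_ord0. Qed.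

(** Each reply depends only on earlier rounds, so appending [a] leaves all previous payoffs
    unchanged. *)
Lemma payoff_rcons (R : realType) (m n : nat) (uA uB : 'I_m.+1 -> 'I_n.+1 -> R) h a :
  payoff uA uB (rcons h a) = payoff uA uB h + uA a (ERM uB h).
Proof.
rewrite /payoff size_rcons big_ord_recr /= nth_rcons ltnn eqxx.
rewrite -cats1 take_size_cat //; congr (_ + _); apply: eq_bigr => i _.
by rewrite nth_cat ltn_ord take_cat ltn_ord.
Qed.

Section RepeatCycle.

Variables (A : eqType) (x0 : A) (x : seq A).

Lemma repeat_cycleS T :
  repeat_cycle x0 x T.+1 = rcons (repeat_cycle x0 x T) (nth x0 x (T %% size x)).
Proof. by rewrite /repeat_cycle mkseqS. Qed.

Lemma leq_count_repeat_cycle (p : pred A) T1 T2 : (T1 <= T2)%N ->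
  (count p (repeat_cycle x0 x T1) <= count p (repeat_cycle x0 x T2))%N.
Proof.
move=> /subnKC <-.
by rewrite /repeat_cycle /mkseq iotaD map_cat count_cat leq_addr.
Qed.

(** Every complete pass through [x] contributes at least one hit; by monotonicity it suffices to
    count at multiples of [size x]. *)
Lemma count_repeat_cycle_ge (p : pred A) T : has p x ->
  (T %/ size x <= count p (repeat_cycle x0 x T))%N.
Proof.
move=> px.
suff le_k k : (k <= count p (repeat_cycle x0 x (k * size x)))%N.
  by apply: leq_trans (le_k _) _; apply/leq_count_repeat_cycle/leq_divM.
elim: k => // k IHk; rewrite mulSnr /repeat_cycle /mkseq iotaD map_cat count_cat.
rewrite -addn1; apply: leq_add => //; rewrite add0n -has_count has_map.
apply/hasP; exists (k * size x + find p x)%N.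
  by rewrite mem_iota leq_addr ltn_add2l -has_find.
by rewrite /= modnMDl modn_small ?nth_find // -has_find.
Qed.

Lemma count_repeat_cycle0 (p : pred A) T : (0 < size x)%N -> ~~ has p x ->
  count p (repeat_cycle x0 x T) = 0%N.
Proof.
move=> x_gt0 /hasPn px; elim: T => // T IHT.
rewrite repeat_cycleS -cats1 count_cat IHT /= addn0.
by rewrite (negPf (px _ _)) // mem_nth // ltn_mod.
Qed.

End RepeatCycle.

Lemma ord2_neq0 (i : 'I_2) : i != ord0 -> i = ord_max.
Proof. by case: i => [[|[|]]] //= ? _; apply: val_inj. Qed.

Section PatienceGame.

Variables (R : realType) (K : nat).
Hypothesis K_gt0 : (0 < K)%N.

Definition patience_A (a b : 'I_2) : R :=
  if a == ord0 then 0 else if b == ord0 then -1 else 1.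

Definition patience_B (a b : 'I_2) : R :=
  if b == ord0 then 0 else if a == ord0 then K%:R^-1 else -1.

Let zeros (h : seq 'I_2) := count (pred1 ord0) h.
Let ones (h : seq 'I_2) := count (predC1 ord0) h.

Lemma patience_score0 h : score patience_B h ord0 = 0.
Proof. by rewrite /score big1. Qed.

Lemma patience_score1 h :
  score patience_B h ord_max = (zeros h)%:R / K%:R - (ones h)%:R.
Proof.
rewrite /score /zeros /ones; elim: h => [|a h IHh].
  by rewrite big_nil mul0r subr0.
rewrite big_cons IHh /patience_B /= !natrD mulrDl.
by case: (a == ord0); rewrite /= ?mul1r ?mul0r; lra.
Qed.

Lemma patience_score1_gt0 h :
  (0 < score patience_B h ord_max) = (K * ones h < zeros h)%N.
Proof.
rewrite patience_score1 subr_gt0 ltr_pdivlMr ?ltr0n //.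
by rewrite -natrM ltr_nat mulnC.
Qed.

(** Column 0 always scores 0 and wins ties as the leftmost column, so column 1 is played exactly
    when its score is strictly positive. *)
Lemma patience_ERM h : (ERM patience_B h != ord0) = (K * ones h < zeros h)%N.
Proof.
rewrite -patience_score1_gt0; apply/idP/idP => [E0|s_gt0].
  rewrite -(ord2_neq0 E0) -(patience_score0 h); apply: ERM_leftmost.
  by rewrite lt0n.
apply/eqP => E0; have := ERM_max patience_B h ord_max.
by rewrite E0 patience_score0 leNgt s_gt0.
Qed.

Lemma patience_payoff_rcons h a :
  payoff patience_A patience_B (rcons h a) = payoff patience_A patience_B h +
    (if a == ord0 then 0 else if (K * ones h < zeros h)%N then 1 else -1).
Proof.
rewrite payoff_rcons -patience_ERM /patience_A.
by case: (ERM patience_B h == ord0).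
Qed.

(** The exact value is needed, not just an upper bound: [q] is evaluated at it and need not be
    monotone. *)
Lemma patience_max_payoff : max_payoff patience_A patience_B = 1.
Proof.
apply/le_anti/andP; split; last first.
  rewrite /max_payoff; apply: le_trans (le_bigmax _ _ (ord_max, ord_max)).
  by rewrite /patience_A /= normr1 le_max lexx.
apply: bigmax_le => // -[a b] _ /=.
rewrite ge_max /patience_A /patience_B.
have K1 : `|K%:R^-1| <= 1 :> R.
  by rewrite normfV normr_nat invf_le1 ?ltr0n // ler1n.
by case: (a == ord0); case: (b == ord0);
  rewrite ?normr0 ?normrN ?normr1 ?ler01 ?lexx.
Qed.

Lemma patience_payoff_wait M :
  payoff patience_A patience_B (nseq (K * M) ord0 ++ nseq M ord_max) = M%:R.
Proof.
have nseqSr T (y : T) n : nseq n.+1 y = rcons (nseq n y) y.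
  by rewrite -cats1 -[[:: y]]/(nseq 1 y) -nseqD addn1.
have pay0 n : payoff patience_A patience_B (nseq n ord0) = 0.
  elim: n => [|n IHn]; first by rewrite payoff_nil.
  by rewrite nseqSr patience_payoff_rcons IHn addr0.
(* Induct on the number [k] of ones played while the [K * M] zeros stay fixed; the next 1 earns 1
   because [K * k < K * M]. *)
suff pay k : (k <= M)%N ->
    payoff patience_A patience_B (nseq (K * M) ord0 ++ nseq k ord_max) = k%:R.
  exact: pay.
elim: k => [|k IHk] kM; first by rewrite cats0 pay0.
rewrite nseqSr -rcons_cat patience_payoff_rcons (IHk (ltnW kM)).
rewrite /zeros /ones !count_cat !count_nseq /= mul1n mul0n add0n addn0 mul1n.
by rewrite ltn_pmul2l // kM -natr1.
Qed.

Lemma patience_OPT_ge M : M%:R <= OPT patience_A patience_B (K * M + M).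
Proof.
have szE : size (nseq (K * M) ord0 ++ nseq M (ord_max : 'I_2)) == (K * M + M)%N.
  by rewrite size_cat !size_nseq.
by rewrite -(patience_payoff_wait M); apply: (payoff_le_OPT _ _ (Tuple szE)).
Qed.

Lemma patience_payoff_no_ones h :
  ones h = 0%N -> payoff patience_A patience_B h = 0.
Proof.
elim/last_ind: h => [|h a IHh]; first by rewrite payoff_nil.
rewrite /ones -cats1 count_cat cats1 patience_payoff_rcons /= => /eqP.
by rewrite addn_eq0 => /andP[/eqP/IHh -> ]; case: (a == ord0); rewrite ?addr0.
Qed.

Lemma patience_payoff_cycle (x : seq 'I_2) T :
  (0 < size x)%N -> (2 * size x <= K)%N -> (2 * size x <= T)%N ->
  payoff patience_A patience_B (repeat_cycle ord0 x T) <= 0.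
Proof.
move=> x_gt0 lK lT.
have [hasx|nhasx] := boolP (has (predC1 ord0) x); last first.
  by rewrite patience_payoff_no_ones // /ones count_repeat_cycle0.
(* The 2 absorbs the first 1, which may earn 1; every later 1 costs 1. *)
have pay t (h := repeat_cycle ord0 x t) :
    payoff patience_A patience_B h
      <= if ones h == 0%N then 0 else 2 - (ones h)%:R.
  rewrite {}/h; elim: t => [|t]; first by rewrite payoff_nil.
  rewrite repeat_cycleS; set h := repeat_cycle _ _ t; set a := nth _ _ _ => IHt.
  (* With l the cycle length and o > 0 the number of ones, t < (t %/ l + 1) l <= (o + 1) l <= 2 l o
     <= K o, and there are at most t zeros. *)
  have few0 : (0 < ones h)%N -> (K * ones h < zeros h)%N = false.
    have /= ge1 := count_repeat_cycle_ge ord0 t hasx.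
    have tlt := ltn_ceil t x_gt0.
    have : (zeros h <= t)%N.
      by rewrite (leq_trans (count_size _ _)) // size_mkseq.
    rewrite -/(ones h) in ge1.
    by move=> zt o_gt0; apply/negbTE; rewrite -leqNgt; nia.
  rewrite patience_payoff_rcons.
  have -> : ones (rcons h a) = (ones h + (a != ord0))%N.
    by rewrite /ones -cats1 count_cat /= addn0.
  have [a0|a0] := eqVneq a ord0; first by rewrite /= addr0 addn0.
  (* At the first 1 the bound rises from 0 to 1, which covers either reply; afterwards [few0] forces
     column 0, and payoff and bound both drop by 1. *)
  rewrite addn1 /= -natr1; case: posnP few0 IHt => [o0 _|o_gt0 -> //].
    by rewrite /h o0 /= => IHt; case: ifP => _; lra.
  by move=> IHt; lra.
apply: le_trans (pay T) _ => /=.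
(* Two full passes fit into [T] rounds, so the bound is at most 0. *)
have : (2 <= ones (repeat_cycle ord0 x T))%N.
  apply: leq_trans (count_repeat_cycle_ge ord0 T hasx).
  by rewrite leq_divRL.
by case: eqP => // _; rewrite -(ler_nat R) => ?; lra.
Qed.

End PatienceGame.

Theorem proposition5 (R : realType) (q : {mpoly R[2]}) (C : R) (hC : 0 < C) :
  exists (m n : nat) (uA uB : 'I_m.+1 -> 'I_n.+1 -> R) (T : nat),
    forall (l : nat) (x : l.-tuple 'I_m.+1),
      (0 < l)%N ->
      l%:R <= q.@[tnth [tuple (#|'I_m.+1| + #|'I_n.+1|)%:R; max_payoff uA uB]] ->
      (forall rho : R, 0 < rho ->
         payoff uA uB (repeat_cycle ord0 x T) < rho * OPT uA uB T) /\
      payoff uA uB (repeat_cycle ord0 x T) < OPT uA uB T - C.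
Proof.
(* [L] exceeds every admissible cycle length, [K] is at least twice any such length, and [M > C]
   makes the optimum exceed [C]. *)
pose L := Num.bound `|q.@[tnth [tuple (#|'I_2| + #|'I_2|)%:R; 1]]|.
pose K := (2 * L.+1)%N; pose M := Num.bound C.
have K_gt0 : (0 < K)%N by [].
have CM : C < M%:R by apply: archi_boundP; apply: ltW.
have M_gt0 : (0 < M)%N by rewrite -(ltr0n R) (lt_trans hC).
exists 1%N, 1%N, (@patience_A R), (@patience_B R K), (K * M + M)%N => l x l_gt0.
rewrite patience_max_payoff // => lq.
have lL : (l < L)%N.
  rewrite -(ltr_nat R); apply: le_lt_trans lq _.
  exact: le_lt_trans (ler_norm _) (archi_boundP (normr_ge0 _)).
have OPT_ge := patience_OPT_ge R K_gt0 M.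
have pay : payoff (@patience_A R) (@patience_B R K)
    (repeat_cycle ord0 x (K * M + M)) <= 0.
  by apply: patience_payoff_cycle; rewrite ?size_tuple // /K; nia.
split=> [rho rho_gt0|]; last by lra.
apply: le_lt_trans pay _; rewrite mulr_gt0 //; lra.
Qed.
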